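(* Let $(a_n)_{n=1}^\infty$ be a strictly decreasing sequence of positive numbers with $a_n\to 0$ as $n\to\infty$. Suppose in addition that \[ \sup_{m>n>1}\frac{a_{m-1}-a_m}{a_{n-1}-a_n}<\infty, \] where the supremum is over integers $m>n>1$. Then $(a_n)_{n=1}^\infty$ is bi-Lipschitz measure universal if and only if \[ \limsup_{n\to\infty}\frac{a_{n+1}}{a_n}<1. \]
   Context: A map $f:\mathbb{R}\to\mathbb{R}$ is bi-Lipschitz if there exists a constant $L>1$ such that $L^{-1}|x-y|\le |f(x)-f(y)|\le L|x-y|$ for all $x,y\in\mathbb{R}$. A set $A\subset\mathbb{R}$ can be bi-Lipschitz embedded into a set $E\subset\mathbb{R}$ if there is a bi-Lipschitz map $f:\mathbb{R}\to\mathbb{R}$ with $f(A)\subset E$. A set $A$ is bi-Lipschitz measure universal if it can be bi-Lipschitz embedded into every Lebesgue measurable subset of $\mathbb{R}$ of positive Lebesgue measure. A sequence $(a_n)_{n=1}^\infty$ is identified with the set $\{a_n: n\ge 1\}$. *)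

(* Defs.v *)
From mathcomp Require Import all_boot all_order all_algebra.
From mathcomp Require Import all_classical all_reals all_analysis.

Set Implicit Arguments.
Unset Strict Implicit.
Unset Printing Implicit Defensive.

Import Order.TTheory GRing.Theory Num.Theory.
Import numFieldNormedType.Exports.

Local Open Scope classical_set_scope.
Local Open Scope ring_scope.

Definition bilipschitz (R : realType) (f : R -> R) : Prop :=
  exists2 L : R, 1 < L &
    forall x y : R, L^-1 * `|x - y| <= `|f x - f y| <= L * `|x - y|.

Definition bilipschitz_embeds (R : realType) (A E : set R) : Prop :=
  exists2 f : R -> R, bilipschitz f & f @` A `<=` E.

(* The Lebesgue sigma-algebra (not just the Borel one, which is the canonical
   sigma-algebra on R): it consists of the Caratheodory-measurable sets for the
   Lebesgue outer measure and is the domain of completed_lebesgue_measure. *)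
Definition lebesgue_measurable (R : realType) (E : set R) : Prop :=
  ((wlength (@idfun R))^*)%mu.-cara.-measurable E.

Definition bilipschitz_measure_universal (R : realType) (A : set R) : Prop :=
  forall E : set R, lebesgue_measurable E ->
    (0 < completed_lebesgue_measure E)%E -> bilipschitz_embeds A E.

(* Main.v *)
(* If the ratios a_(n+1)/a_n stay below some e < 1, then each gap
   a_n - a_(n+1) is at least c * a_n.  At a density point x0 of E and for a
   small scale t, every x0 + t * a_n is within (c/4) * t * a_n of a point y_n of
   E; these displacements are (t/2)-Lipschitz on the sequence, so they extend to
   a (t/2)-Lipschitz g, and x0 + t * x + g x is bi-Lipschitz.

   Otherwise some n have a_n - a_(n+1) = o(a_n), and the hypothesis on the gaps
   transfers this to all later gaps: {a_k : k >= n} is o(a_n)-dense in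
   [0, a_n].  Remove from [0, 1], for each j, a p_j-periodic family of intervals
   of length d_j, where p_j is about a_n / j, d_j / p_j is summable, and yet d_j
   exceeds j times all gaps after n.  An L-Lipschitz image with L <= j takes
   steps shorter than d_j while crossing a whole period, hence meets a removed
   interval. *)
Require Import Defs.
From mathcomp Require Import all_boot all_order all_algebra.
From mathcomp Require Import all_classical all_reals all_analysis.
From mathcomp Require Import ring lra.
Set Implicit Arguments.
Unset Strict Implicit.
Unset Printing Implicit Defensive.

Import Order.TTheory GRing.Theory Num.Theory.
Import numFieldNormedType.Exports.

Local Open Scope classical_set_scope.
Local Open Scope ring_scope.

(** * Upper limits and extension of Lipschitz functions *)

Lemma limn_esup_lt_EFin (R : realType) (u : nat -> R) (l : R) :
  (limn_esup (EFin \o u) < l%:E)%E <->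
  exists2 e : R, e < l & \forall n \near \oo, u n <= e.
Proof.
split=> [|[e el ue]].
  move/ereal_inf_lt => [y [V V_near <-]]; set s := ereal_sup _ => s_l.
  (* [l - 1] is a dummy: [s < l] excludes [+oo], and [-oo] bounds no real [u n]. *)
  exists (if s is r%:E then r else l - 1).
    by case: s s_l => [r||]; rewrite ?lte_fin // => _; lra.
  apply: filterS V_near => n Vn.
  have : ((u n)%:E <= s)%E by apply: ereal_sup_ubound; exists n.
  by case: s s_l => [r||]; rewrite ?lee_fin //.
rewrite (@le_lt_trans _ _ e%:E) ?lte_fin //.
apply: le_trans (ereal_inf_lbound _) _; first by exists [set n | u n <= e].
by apply: ge_ereal_sup => _ [n /= un <-]; rewrite lee_fin.
Qed.

Lemma lipschitz_extension (R : realType) (I : Type) (i0 : I) (t h : I -> R)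
    (k : R) (k_ge0 : 0 <= k)
    (h_lip : forall i j, `|h i - h j| <= k * `|t i - t j|) :
  exists2 g : R -> R, (forall x y, `|g x - g y| <= k * `|x - y|) &
    (forall i, g (t i) = h i).
Proof.
(* McShane's formula: the upper envelope of downward cones of slope k. *)
pose S x := [set h i - k * `|x - t i| | i in [set: I]].
have S_neq0 x : S x !=set0 by exists (h i0 - k * `|x - t i0|), i0.
have cone_le x y i : h i - k * `|x - t i| <= h i - k * `|y - t i| + k * `|x - y|.
  have : k * `|y - t i| <= k * (`|x - y| + `|x - t i|).
    by rewrite ler_wpM2l // (distrC x y) ler_distD.
  lra.
(* No cone exceeds the data at any node; hence the suprema are finite and the envelope
   interpolates. *)
have cone_ub i j : h j - k * `|t i - t j| <= h i.
  by have := h_lip j i; rewrite (distrC (t j)) ler_norml => /andP[_]; lra.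
have S_sup x : has_sup (S x).
  split=> //; exists (h i0 + k * `|x - t i0|) => _ [i _ <-].
  exact: le_trans (cone_le x (t i0) i) (lerD (cone_ub i0 i) (lexx _)).
have sup_lip x y : sup (S x) <= sup (S y) + k * `|x - y|.
  apply: ge_sup => // _ [i _ <-]; apply: le_trans (cone_le x y i) _.
  by rewrite lerD2r; apply: sup_upper_bound => //; exists i.
exists (fun x => sup (S x)) => [x y|i].
  rewrite ler_norml; have := sup_lip x y; have := sup_lip y x.
  by rewrite (distrC y); lra.
apply/eqP; rewrite eq_le; apply/andP; split.
  by apply: ge_sup => // _ [j _ <-].
apply: sup_upper_bound => //; exists i => //.
by rewrite subrr normr0 mulr0 subr0.
Qed.

(** * Borel subsets and density points *)

(** A set of the completed sigma-algebra is a Borel set [B] plus a part of a null Borel set [M], so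
    [B] carries all of the measure. The density theorem can then be applied to [B]. *)
Lemma lebesgue_measurable_ex_borel (R : realType) (E : set R) :
  lebesgue_measurable E -> (0 < completed_lebesgue_measure E)%E ->
  exists B : set (measurableTypeR R),
    [/\ measurable B, B `<=` E & (0 < lebesgue_measure B)%E].
Proof.
rewrite /lebesgue_measurable -completed_caratheodory_measurable.
rewrite g_sigma_completed_algebra_genE => -[B mB [N [M [mM M0 NM]] <-]] E_gt0.
exists B; split => //.
rewrite (lt_le_trans E_gt0) // (@le_trans _ _ (lebesgue_measure (B `|` M))) //.
  by apply: le_outer_measure; exact: setUS.
by rewrite -[leRHS]adde0 -M0; exact: measureU2.
Qed.

Lemma ex_right_density_point (R : realType) (B : set (measurableTypeR R)) :
  measurable B -> (0 < lebesgue_measure B)%E ->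
  exists x : R, forall e : R, 0 < e < 1 ->
    \forall r \near (0 : R)^'+, exists2 y, B y & `|y - (x + r)| <= e * r.
Proof.
move=> mB B_gt0.
have [x [Bx dx]] : exists x, B x /\
    (lebesgue_measure (B `&` ball x r) * (lebesgue_measure (ball x r))^-1
      @[r --> 0^'+] --> (\1_B x)%:E)%E.
  apply: contrapT => noB; move: B_gt0; rewrite lt0e => /andP[/eqP + _]; apply.
  apply/negligibleP => //; apply: negligibleS (lebesgue_density mB) => x Bx dx.
  by apply: noB; exists x.
exists x => e /andP[e_gt0 e_lt1].
have rho_gt0 : 0 < 1 + e by lra.
move: dx; rewrite indicE mem_set // => /fine_cvgP[_ /cvgr_gt].
move=> /(_ (1 + e)^-1).
rewrite invf_lt1 // ltrDl => /(_ e_gt0) [d /= d_gt0 dens].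
near=> r.
have r_gt0 : 0 < r by near: r; exact: nbhs_right_gt.
(* The ball of radius [s] about [x] ends where the window around [x + r] ends. *)
pose s := r * (1 + e).
have s_gt0 : 0 < s by exact: mulr_gt0.
have s_lt : s < d.
  by rewrite -ltr_pdivlMr //; near: r; apply: nbhs_right_lt; exact: divr_gt0.
have := dens s; rewrite /= sub0r normrN gtr0_norm // => /(_ s_lt s_gt0).
rewrite lebesgue_measure_ball ?ltW // inver.
apply: contraPP => noy.
(* If B misses the window around x + r, the ball of radius s = (1 + e) * r about
   x meets B inside an interval of length 2 * r, so the density of B at that
   scale is at most (1 + e)^-1. *)
have B_sub : B `&` ball x s `<=` [set` `]x - s, x + r * (1 - e)[].
  move=> y [By]; rewrite /ball /= in_itv /= ltr_norml => xys.
  apply/andP; split; first lra.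
  rewrite ltNge; apply/negP => y_ge; apply: noy; exists y => //.
  rewrite ler_norml; move: xys y_ge; rewrite /s; nra.
have s2_gt0 : 0 < s *+ 2 by rewrite pmulrn_rgt0.
rewrite (gt_eqF s2_gt0); set m := lebesgue_measure _.
have m_le : (m <= (r *+ 2)%:E)%E.
  apply: le_trans (le_measure _ _ _ B_sub) _; rewrite ?inE.
  - by apply: measurableI => //; rewrite ball_itv; exact: measurable_itv.
  - exact: measurable_itv.
  - rewrite [leLHS]lebesgue_measure_itv /= lte_fin ifT; last by rewrite /s; nra.
    by rewrite -EFinB lee_fin /s; lra.
have m_ge0 : (0 <= m)%E by exact: measure_ge0.
case: m m_le m_ge0 => [q||] //; rewrite lee_fin => q_le _ /=.
rewrite ltr_pdivlMr // /s mulrnAr mulrCA mulVf ?gt_eqF // mulr1.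
by rewrite ltNge q_le.
Unshelve. all: by end_near. Qed.

(** * A discrete intermediate value property *)

(** Steps of size at most [s] cannot jump over an interval longer than [s]: in the descending case
    the first term below [y] follows a term at or above [y], hence is still above [x]. *)
Lemma ex_mem_between (R : realType) (b : nat -> R) (l x y s : R) :
  b n @[n --> \oo] --> l -> (forall n, `|b n - b n.+1| <= s) -> s < y - x ->
  l < x /\ y <= b 0 \/ b 0 <= x /\ y < l ->
  exists n, x < b n < y.
Proof.
move=> bl bs syx; wlog [lx yb] : b l x y syx bl bs / l < x /\ y <= b 0 => [H|_].
  case=> [lx|[bx yl]]; first by apply: (H b l) => //; left.
  have P : - l < - y /\ - x <= - b 0 by rewrite ltrN2 lerN2.
  have [|||n /andP[ny nx]] := H (\- b) (- l) (- y) (- x) _ _ _ P (or_introl P).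
  - by lra.
  - exact: cvgN.
  - by move=> n; rewrite -opprD normrN.
  - by exists n; move: ny nx => /=; rewrite !ltrN2 => -> ->.
have s_ge0 : 0 <= s := le_trans (normr_ge0 _) (bs 0).
have ex_lt : exists n, b n < y.
  have [N _ N_lt] := @cvgr_lt _ _ _ _ _ _ bl x lx.
  by exists N; have := N_lt N (leqnn N); rewrite /=; lra.
have [[|n] bn n_min] := ex_minnP ex_lt; first lra.
exists n.+1; rewrite bn andbT.
have : y <= b n by rewrite leNgt; apply/negP => /n_min; rewrite ltnn.
by have := bs n; rewrite ler_norml; lra.
Qed.

(** * Sufficiency: embedding lacunary sequences *)

Lemma lacunary_universal (R : realType) (b : nat -> R) (c : R) :
  0 < c -> (forall n, 0 < b n) ->
  (forall m n, (m < n)%N -> c * b m <= b m - b n) ->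
  bilipschitz_measure_universal (range b).
Proof.
move=> c_gt0 b_gt0 bc E /lebesgue_measurable_ex_borel/[apply] -[B [mB BE B_gt0]].
have [x0 x0_dens] := ex_right_density_point mB B_gt0.
have b_le m n : (m <= n)%N -> b n <= b m.
  rewrite leq_eqVlt => /predU1P[-> //|/bc].
  by have := mulr_gt0 c_gt0 (b_gt0 m); lra.
have c_lt1 : c < 1 by have := bc 0 1 isT; have := b_gt0 0; have := b_gt0 1; nra.
have /x0_dens [d /= d_gt0 dens] : 0 < c / 4 < 1 by lra.
(* With this scale every [t * b n] is at most [d / 2], in the range where [dens] applies. *)
pose t := d / (2 * b 0).
have t_gt0 : 0 < t by rewrite divr_gt0 // mulr_gt0.
have [y /all_and2[yB y_near]] : {y : nat -> R & forall n,
    B (y n) /\ `|y n - (x0 + t * b n)| <= c / 4 * (t * b n)}.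
  apply: (@choice _ _ (fun n z => B z /\ `|z - _| <= _)) => n.
  have tb_gt0 := mulr_gt0 t_gt0 (b_gt0 n).
  have [|//|z Bz z_near] := dens (t * b n); last by exists z.
  rewrite /= sub0r normrN gtr0_norm // (@le_lt_trans _ _ (t * b 0)) //.
    by rewrite ler_pM2l // b_le.
  by rewrite /t invfM mulrA -mulrA mulVf ?gt_eqF // mulr1; lra.
pose h n := y n - (x0 + t * b n).
(* Both displacements are at most [c / 4 * (t * b m)], and [c * b m <= b m - b n]. *)
have h_lip_lt m n : (m < n)%N -> `|h m - h n| <= t / 2 * `|b m - b n|.
  move=> mn; have bmn := b_le _ _ (ltnW mn).
  rewrite [`|b m - _|]ger0_norm ?subr_ge0 //.
  have := ler_normB (h m) (h n); have := y_near m; have := y_near n.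
  have := bc _ _ mn; rewrite -/(h m) -/(h n) => Hc Hn Hm Hmn.
  have : t * (c * b m) <= t * (b m - b n) by rewrite ler_pM2l.
  have : c * (t * b n) <= c * (t * b m) by rewrite !ler_pM2l.
  lra.
have h_lip m n : `|h m - h n| <= t / 2 * `|b m - b n|.
  case: (ltngtP m n) => [mn|nm|->]; first exact: h_lip_lt.
    by rewrite distrC (distrC (b m)); exact: h_lip_lt.
  by rewrite !subrr normr0 mulr0.
have [|g g_lip gb] := lipschitz_extension 0 _ h_lip; first lra.
exists (fun x => x0 + t * x + g x); last first.
  move=> _ [_ [n _ <-] <-]; apply: BE.
  by rewrite gb /h addrC subrK.
have tV_gt0 : 0 < t^-1 by rewrite invr_gt0.
(* The map distorts distances by factors between [t / 2] and [3 * t / 2]; the summand 1 makes the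
   constant exceed 1. *)
exists (2 * t + 2 / t + 1) => [|x z]; first lra.
have -> : x0 + t * x + g x - (x0 + t * z + g z) = t * (x - z) + (g x - g z) by lra.
have := lerB_normD (t * (x - z)) (g x - g z).
have := ler_normD (t * (x - z)) (g x - g z).
have := g_lip x z; rewrite normrM (gtr0_norm t_gt0).
have := normr_ge0 (x - z).
set X := `|x - z|; set D := `|g x - g z| => X_ge0 D_le hi lo.
have L_gt0 : 0 < 2 * t + 2 / t + 1 by lra.
apply/andP; split.
  apply: le_trans (_ : t / 2 * X <= _); last lra.
  rewrite ler_wpM2r // -[leRHS]invrK lef_pV2 ?posrE ?invr_gt0 //; last lra.
  by rewrite invfM invrK; lra.
apply: le_trans hi _; apply: le_trans (_ : (2 * t) * X <= _).
  by have := mulr_ge0 (ltW t_gt0) X_ge0; lra.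
by rewrite ler_wpM2r //; lra.
Qed.

(** * Necessity: a large set with periodic holes *)

(** At most [2 / p j] holes of length [d j] are removed at stage [j], so that stage costs at most
    [2^-1 / 2 ^ j.+1]. All stages together cost at most 1/2 of the unit interval. *)
Lemma ex_large_set_avoiding (R : realType) (p d : nat -> R) :
  (forall j, 0 < p j <= 1) -> (forall j, 0 < d j <= p j / (2 ^ j.+3)%:R) ->
  exists E : set R, [/\ lebesgue_measurable E,
    (0 < completed_lebesgue_measure E)%E, E `<=` [set x | 0 <= x <= 1] &
    forall j i x, E x -> ~ (i%:R * p j < x < i%:R * p j + d j)].
Proof.
move=> p01 dp.
(* This counts the multiples [i%:R * p j] in [0, 1], including 0. *)
pose N j := (Num.truncn (p j)^-1).+1.
pose I j i : set (measurableTypeR R) := [set` `]i%:R * p j, i%:R * p j + d j[].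
pose U j := \big[setU/set0]_(i < N j) I j i.
have mI j i : measurable (I j i) by exact: measurable_itv.
have mU j : measurable (U j) by apply: bigsetU_measurable.
pose J : set (measurableTypeR R) := [set` `[0, 1]].
have mJ : measurable J by exact: measurable_itv.
pose E := J `\` \bigcup_j U j.
have mUU : measurable (\bigcup_j U j) by exact: bigcupT_measurable.
have mE : measurable E by exact: measurableD.
have muI j i : lebesgue_measure (I j i) = (d j)%:E.
  rewrite [LHS]lebesgue_measure_itv /= lte_fin ltrDl; case/andP: (dp j) => -> _.
  by rewrite -EFinB addrAC subrr add0r.
have muU j : (lebesgue_measure (U j) <= (2^-1 / (2 ^ j.+1)%:R)%:E)%E.
  apply: le_trans (_ : _ <= \sum_(i < N j) lebesgue_measure (I j i))%E _.
    by apply: (@content_subadditive _ _ _ _ (U j) (I j) (N j)).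
  under eq_bigr do rewrite muI.
  rewrite sumEFin lee_fin sumr_const card_ord -[leLHS]mulr_natl.
  have [p_gt0 p_le1] := andP (p01 j); have [d_gt0 d_le] := andP (dp j).
  have pV_ge1 : 1 <= (p j)^-1 by rewrite -invr1 lef_pV2 ?posrE.
  have N_le : (N j)%:R <= 2 / p j.
    have : (Num.truncn (p j)^-1)%:R <= (p j)^-1 by rewrite truncn_le; lra.
    by rewrite /N -natr1; lra.
  apply: le_trans (ler_pM (ler0n _ _) (ltW d_gt0) N_le d_le) _.
  by rewrite mulrA divfK ?gt_eqF // !expnS !natrM !invfM; lra.
have muUU : (lebesgue_measure (\bigcup_j U j) <= (2^-1)%:E)%E.
  have := @measure_sigma_subadditive _ _ _ (@lebesgue_measure R) _ U mU mUU.
  move=> /(_ (@subset_refl _ _))/le_trans; apply.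
  apply: le_trans (epsilon_trick0 _ _); last by lra.
  by apply: lee_nneseries => // j _; exact: muU.
exists E; split.
- exact: sub_caratheodory.
- rewrite [X in (0 < X)%E](_ : _ = lebesgue_measure E) //.
  have : (1 <= lebesgue_measure E + 2^-1%:E)%E.
    have <- : lebesgue_measure J = 1%E.
      by rewrite [LHS]lebesgue_measure_itv /= lte_fin ltr01 oppr0 adde0.
    apply: (@le_trans _ _ (lebesgue_measure (E `|` \bigcup_j U j))).
      apply: le_measure; rewrite ?inE //; first exact: measurableU.
      by rewrite /E setDE setUIl setUCl setIT; exact: subsetUl.
    by apply: le_trans (measureU2 _ mE mUU) _; exact: leeD2l.
  have : (0 <= lebesgue_measure E)%E by exact: measure_ge0.
  case: (lebesgue_measure E) => [r||] //=; rewrite -?EFinD !lee_fin lte_fin; lra.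
- by move=> x [+ _]; rewrite /J /= in_itv.
- move=> j i x [+ nUx] ix; rewrite /J /= in_itv /= => /andP[x_ge0 x_le1].
  case/andP: (p01 j) => p_gt0 _.
  apply: nUx; exists j => //; rewrite /U -bigcup_mkord; exists i; last first.
    by rewrite /I /= in_itv.
  have pV_ge0 : 0 <= (p j)^-1 by rewrite invr_ge0 ltW.
  by rewrite /= /N ltnS truncn_ge_nat // -[leRHS]div1r ler_pdivlMr //; lra.
Qed.

Lemma gap_ratio_bound (R : realType) (a : nat -> R) :
  (forall m n : nat, (1 <= m < n)%N -> a n < a m) ->
  (ereal_sup [set q : \bar R | exists m n : nat, (1 < n < m)%N /\
      q = ((a m.-1 - a m) / (a n.-1 - a n))%:E] < +oo)%E ->
  exists2 C, 1 <= C & forall n k, (1 <= n)%N ->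
    a (n + k)%N - a (n + k).+1 <= C * (a n - a n.+1).
Proof.
move=> a_decr; set s := ereal_sup _ => s_fin.
have [C C_ge] : exists C, (s <= C%:E)%E.
  by case: s s_fin => [r||] // _; [exists r | exists 0; rewrite leNye].
(* The supremum runs over distinct indices only; the maximum with 1 covers [k = 0]. *)
exists (Num.max 1 C) => [|n k n_gt0]; first by rewrite le_max lexx.
have gap_gt0 : 0 < a n - a n.+1 by rewrite subr_gt0 a_decr // n_gt0 ltnSn.
have max_ge1 : 1 <= Num.max 1 C by rewrite le_max lexx.
case: k => [|k]; first by rewrite addn0; nra.
rewrite -ler_pdivrMr // le_max; apply/orP; right; rewrite -lee_fin.
apply: le_trans C_ge; apply: ereal_sup_ubound.
exists (n + k.+1).+1, n.+1; split => //.
by rewrite ltnS n_gt0 !ltnS addnS ltnS leq_addr.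
Qed.

Lemma universal_ratio_lt1 (R : realType) (a : nat -> R) (C : R) :
  (forall n : nat, (1 <= n)%N -> 0 < a n) ->
  (forall m n : nat, (1 <= m < n)%N -> a n < a m) ->
  a n @[n --> \oo] --> (0 : R) ->
  1 <= C ->
  (forall n k, (1 <= n)%N ->
    a (n + k)%N - a (n + k).+1 <= C * (a n - a n.+1)) ->
  bilipschitz_measure_universal [set a n | n in [set n : nat | (1 <= n)%N]] ->
  exists2 e : R, e < 1 & \forall n \near \oo, a n.+1 / a n <= e.
Proof.
move=> a_gt0 a_decr a_lim C_ge1 a_gap univ; apply: contrapT => no_e.
have C_gt0 : 0 < C by lra.
(* Otherwise [1 - eta] would be an eventual bound for the ratios. *)
have small_gap eta : 0 < eta ->
    exists n, [/\ (1 <= n)%N, a n <= 1 & a n - a n.+1 < eta * a n].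
  move=> eta_gt0; apply: contrapT => no_n; apply: no_e; exists (1 - eta); first lra.
  near=> n.
  have n_gt0 : (1 <= n)%N by near: n; exact: nbhs_infty_ge.
  have an_gt0 := a_gt0 n n_gt0.
  rewrite ler_pdivrMr // leNgt; apply/negP => an_lt; apply: no_n; exists n.
  split=> //; last by lra.
  by near: n; apply: (cvgr_le (0 : R)) => //; exact: ltr01.
(* Chosen so that [d j] below equals [a (ns j) / w j]; the factor [j.+1%:R * C] in the choice of
   [ns] pays for the Lipschitz constant and for passing to later gaps. *)
pose w j : R := 2 * j.+1%:R * (2 ^ j.+3)%:R.
have w_gt0 j : 0 < w j by rewrite !mulr_gt0 // ltr0n ?expn_gt0.
have /choice [ns ns_spec] : forall j, exists n, [/\ (1 <= n)%N, a n <= 1 &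
    a n - a n.+1 < (j.+1%:R * C * w j)^-1 * a n].
  by move=> j; apply: small_gap; rewrite invr_gt0 !mulr_gt0.
(* If [L <= j.+1%:R], the images of [a (ns j)] and 0 are at least two periods apart. *)
pose p j := a (ns j) / (2 * j.+1%:R).
pose d j := p j / (2 ^ j.+3)%:R.
have p_gt0 j : 0 < p j.
  by case: (ns_spec j) => /a_gt0 an_gt0 _ _; rewrite divr_gt0 // mulr_gt0.
have d_gt0 j : 0 < d j by rewrite divr_gt0 // ltr0n expn_gt0.
have p_le1 j : p j <= 1.
  have j_ge1 : (1 : R) <= j.+1%:R by rewrite ler1n.
  by case: (ns_spec j) => _ an_le1 _; rewrite ler_pdivrMr ?mulr_gt0 //; lra.
have [|j|E [mE E_gt0 E01 E_gap]] := @ex_large_set_avoiding R p d.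
- by move=> j; rewrite p_gt0 p_le1.
- by rewrite d_gt0 lexx.
have [f [L L_gt1 f_bilip] fE] := univ E mE E_gt0.
pose j := Num.truncn L.
have L_le : L <= j.+1%:R by apply: ltW; exact: truncnS_gt.
have [n_gt0 _ gap_lt] := ns_spec j; set n := ns j in n_gt0 gap_lt.
have an_gt0 := a_gt0 n n_gt0.
have d_lt_p : d j < p j.
  rewrite ltr_pdivrMr ?ltr0n ?expn_gt0 // ltr_pMr // ltr1n.
  by rewrite -{1}(expn0 2) ltn_exp2l.
pose b k := f (a (n + k)%N).
have bE k : E (b k).
  apply: fE; exists (a (n + k)%N) => //; exists (n + k)%N => //=.
  exact: leq_trans n_gt0 (leq_addr _ _).
have b_lim : b k @[k --> \oo] --> f 0.
  apply/cvgrPdist_lt => eps eps_gt0.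
  have [|N _ aN] := @cvgr_lt _ _ _ _ _ _ a_lim (eps / L).
    by rewrite divr_gt0 //; lra.
  exists N => // k Nk; have [_ /le_lt_trans] := andP (f_bilip 0 (a (n + k)%N)).
  apply; rewrite sub0r normrN gtr0_norm; last first.
    by rewrite a_gt0 // (leq_trans n_gt0) // leq_addr.
  rewrite mulrC -ltr_pdivlMr; last lra.
  by apply: aN => /=; rewrite (leq_trans Nk) // leq_addl.
(* Through [a_gap], the single small gap at [n] controls all later steps. *)
have b_step k : `|b k - b k.+1| <= j.+1%:R * C * (a n - a n.+1).
  have [_ /le_trans] := andP (f_bilip (a (n + k)%N) (a (n + k.+1)%N)); apply.
  rewrite -mulrA ler_pM //; first by lra.
  rewrite addnS ger0_norm; first exact: a_gap.
  by rewrite subr_ge0 ltW // a_decr // ltnSn (leq_trans n_gt0) ?leq_addr.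
have step_lt : j.+1%:R * C * (a n - a n.+1) < d j.
  rewrite -ltr_pdivlMl ?mulr_gt0 //; apply: lt_le_trans gap_lt _.
  by rewrite /d /p /w -/n !invfM le_eqVlt; apply/orP; left; apply/eqP; ring.
have b01 k : 0 <= b k <= 1 by apply: E01.
have f0_01 : 0 <= f 0 <= 1.
  rewrite -(cvg_lim (@Rhausdorff R) b_lim); apply/andP; split.
    by apply: limr_ge (cvgP _ b_lim) _; apply: nearW => k; case/andP: (b01 k).
  by apply: limr_le (cvgP _ b_lim) _; apply: nearW => k; case/andP: (b01 k).
have b0_far : 2 * p j <= `|b 0 - f 0|.
  have [+ _] := andP (f_bilip (a (n + 0)%N) 0); apply: le_trans.
  rewrite addn0 subr0 gtr0_norm // /p -/n invfM mulrCA mulVKf ?gt_eqF //.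
  by rewrite mulrC ler_pM2r // lef_pV2 ?posrE //; lra.
(* The first multiple of [p j] beyond [u] is at most [u + p j], and [d j < p j], so two periods
   contain a whole hole. *)
have find_gap u v : 0 <= u -> v <= 1 -> u + 2 * p j <= v ->
    exists i : nat, u < i%:R * p j /\ i%:R * p j + d j < v.
  move=> u_ge0 v_le1 uv; exists (Num.truncn (u / p j)).+1.
  have /andP[] : (Num.truncn (u / p j))%:R <= u / p j < (Num.truncn (u / p j)).+1%:R.
    by apply: truncn_itv; exact: divr_ge0 (ltW _).
  rewrite ler_pdivlMr // ltr_pdivrMr // -natr1 => lo hi; split; lra.
have [k [i b_in]] : exists k i, i%:R * p j < b k < i%:R * p j + d j.
  have enter i := ex_mem_between (x := i%:R * p j) (y := i%:R * p j + d j)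
    b_lim b_step.
  have := b01 0 => /andP[b0_ge0 b0_le1]; have /andP[f0_ge0 f0_le1] := f0_01.
  (* The images may approach [f 0] from either side, according to the orientation of [f]. *)
  have [fb|bf] := ltrP (f 0) (b 0); move: b0_far.
    rewrite ger0_norm => [far|]; last by rewrite subr_ge0 ltW.
    have [|i [i_gt i_lt]] := find_gap _ _ f0_ge0 b0_le1; first lra.
    by have [||k k_in] := enter i; [lra|left; lra|exists k, i].
  rewrite ler0_norm => [far|]; last by rewrite subr_le0.
  have [|i [i_gt i_lt]] := find_gap _ _ b0_ge0 f0_le1; first lra.
  by have [||k k_in] := enter i; [lra|right; lra|exists k, i].
exact: E_gap (bE k) b_in.
Unshelve. all: by end_near. Qed.

(** * The equivalence *)

(* The sequence is indexed by n >= 1; the value a 0 is unconstrained and plays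
   no role. *)
Theorem theorem1p3 (R : realType) (a : nat -> R)
  (a_pos : forall n : nat, (1 <= n)%N -> 0 < a n)
  (a_decr : forall m n : nat, (1 <= m < n)%N -> a n < a m)
  (a_lim : a n @[n --> \oo] --> (0 : R))
  (a_gaps : (ereal_sup [set q : \bar R | exists m n : nat, (1 < n < m)%N /\
      q = ((a m.-1 - a m) / (a n.-1 - a n))%:E] < +oo)%E) :
  bilipschitz_measure_universal [set a n | n in [set n : nat | (1 <= n)%N]] <->
  (limn_esup (fun n : nat => (a n.+1 / a n)%:E) < 1)%E.
Proof.
apply: (iff_trans _ (iff_sym (limn_esup_lt_EFin (fun n => a n.+1 / a n) 1))).
split=> [univ|[e e_lt1 [N _ ratio_le]]].
  have [C C_ge1 a_gap] := gap_ratio_bound a_decr a_gaps.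
  exact: universal_ratio_lt1 a_pos a_decr a_lim C_ge1 a_gap univ.
pose b n := a n.+1.
have b_gt0 n : 0 < b n by exact: a_pos.
have b_lt n : b n.+1 < b n by apply: a_decr; rewrite ltnSn.
have b_anti m n : (m < n)%N -> b n <= b m.+1.
  rewrite leq_eqVlt => /predU1P[<- //|mn].
  by apply/ltW/a_decr; rewrite !ltnS.
(* From [N] on, [1 - e] works; the finitely many earlier relative gaps are positive, and induction
   on [N] takes the minimum. *)
have [c c_gt0 bc] : exists2 c, 0 < c & forall n, c * b n <= b n - b n.+1.
  suff [c [/andP[c_gt0 c_le] bc]] : exists c, 0 < c <= 1 - e /\
      forall n, (n < N)%N -> c * b n <= b n - b n.+1.
    exists c => // n; have [|Nn] := ltnP n N; first exact: bc.
    have : b n.+1 / b n <= e := ratio_le n.+1 (leqW Nn).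
    rewrite ler_pdivrMr // => b_le.
    have : c * b n <= (1 - e) * b n by rewrite ler_pM2r.
    by lra.
  elim: (N) => [|M [c [/andP[c_gt0 c_le] IH]]].
    by exists (1 - e); split=> //; lra.
  exists (Num.min c ((b M - b M.+1) / b M)); split=> [|n].
    by rewrite lt_min ge_min c_gt0 c_le divr_gt0 // subr_gt0.
  rewrite -ler_pdivlMr // ge_min ltnS leq_eqVlt => /predU1P[->|/IH].
    by rewrite lexx orbT.
  by rewrite -ler_pdivlMr // => ->.
rewrite (_ : [set _ | _ in _] = range b); last first.
  apply/seteqP; split=> [_ [[//|n] _ <-]|_ [n _ <-]]; first by exists n.
  by exists n.+1.
(* By monotonicity the consecutive gap at [m] bounds every difference [b m - b n] from below. *)
apply: (lacunary_universal c_gt0 b_gt0) => m n mn.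
by apply: le_trans (bc m) _; rewrite lerB ?b_anti.
Qed.
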